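(* Let $(\mathfrak{g},\bullet,\langle\;,\;\rangle)$ be an $\mathrm{R}$-quadratic left Leibniz algebra which is not a Lie algebra. Then $\dim\mathrm{Leib}(\mathfrak{g})\geq 2$. In particular, an $\mathrm{R}$-quadratic left Leibniz algebra whose metric is Lorentzian is a Lie algebra.
   Context: Algebras are real and finite dimensional. Left Leibniz: $u\bullet(v\bullet w)=(u\bullet v)\bullet w+v\bullet(u\bullet w)$. A metric is a nondegenerate symmetric bilinear form; it is Lorentzian if it has signature $(n-1,1)$, $n=\dim\mathfrak{g}$. A left Leibniz algebra with a metric is $\mathrm{R}$-quadratic if every right multiplication $v\mapsto v\bullet u$ is skew-symmetric. $\mathrm{Leib}(\mathfrak{g})=\mathrm{span}\{u\bullet v+v\bullet u: u,v\in\mathfrak{g}\}$. *)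

(* Defs.v *)
From HB Require Import structures.
From mathcomp Require Import all_boot all_order all_algebra.
From mathcomp Require Import boolp classical_sets reals.

Set Implicit Arguments.
Unset Strict Implicit.
Unset Printing Implicit Defensive.

Import Order.TTheory GRing.Theory Num.Theory.
Local Open Scope ring_scope.

(* The linear span of an arbitrary, possibly infinite, set of vectors: the
   subspace of all linear combinations of finitely many elements of the set
   (mem_vspan). The default 0 is never used, since such a subspace exists. *)
Definition vspan (K : fieldType) (V : vectType K) (A : set V) : {vspace V} :=
  xget 0%VS [set U : {vspace V} | forall v, v \in U <->
    exists2 s : seq V, (forall x, x \in s -> A x) & v \in <<s>>%VS]%classic.

Lemma mem_vspan (K : fieldType) (V : vectType K) (A : set V) (v : V) :
  v \in vspan A <->
  exists2 s : seq V, (forall x, x \in s -> A x) & v \in <<s>>%VS.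
Proof.
rewrite /vspan; case: xgetP => [U _ /(_ v)//|noU]; exfalso.
pose P n := `[< exists2 s : seq V, forall x, x \in s -> A x & \dim <<s>> = n >].
have exP : exists n, P n.
  by exists 0%N; apply/asboolP; exists [::] => //; rewrite span_nil dimv0.
have ubP n : P n -> (n <= \dim {:V})%N.
  by move=> /asboolP[s _ <-]; apply/dimvS/subvf.
case: (ex_maxnP exP ubP) => m /asboolP[s sA sm] max_m.
apply: (noU <<s>>%VS) => w; split; first by exists s.
case=> t tA wt.
have tsA x : x \in s ++ t -> A x by rewrite mem_cat => /orP[/sA|/tA].
have sub : (<<s>> <= <<s ++ t>>)%VS by rewrite span_cat addvSl.
have /eqP-> : <<s>>%VS == <<s ++ t>>%VS.
  by rewrite eqEdim sub sm max_m//; apply/asboolP; exists (s ++ t).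
by rewrite span_cat; apply: subvP wt; exact: addvSr.
Qed.

Section Algebras.
Variables (R : realType) (g : vectType R).
Implicit Types (mul : {bilinear g -> g -> g}) (B : {symmetric g}).

Definition left_leibniz mul : Prop := forall u v w : g,
  mul u (mul v w) = mul (mul u v) w + mul v (mul u w).

Definition lie_algebra mul : Prop :=
  (forall u v : g, mul u v = - mul v u) /\
  (forall u v w : g,
     mul u (mul v w) + mul v (mul w u) + mul w (mul u v) = 0).

Definition Leib mul : {vspace g} :=
  vspan [set x | exists u v : g, x = mul u v + mul v u]%classic.

Definition skew_for B (f : g -> g) : Prop :=
  forall v w : g, B (f v) w = - B v (f w).

Definition R_quadratic mul B : Prop :=
  [/\ left_leibniz mul, nondegenerate B & forall u : g, skew_for B (mul^~ u)].

Definition has_signature B (p q : nat) : Prop :=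
  exists e : (p + q).-tuple g,
    [/\ basis_of {:g} e,
        forall i j : 'I_(p + q), i != j -> B (tnth e i) (tnth e j) = 0,
        forall i : 'I_p, 0 < B (tnth e (lshift q i)) (tnth e (lshift q i)) &
        forall j : 'I_q, B (tnth e (rshift p j)) (tnth e (rshift p j)) < 0].

(* No metric is Lorentzian in dimension 0: there n.-1 + 1 = 1 is not the
   length of a basis. *)
Definition lorentzian B : Prop := has_signature B (\dim {:g}).-1 1.

End Algebras.

(* Main.v *)
Require Import Defs.
From HB Require Import structures.
From mathcomp Require Import all_boot all_order all_algebra.
From mathcomp Require Import boolp classical_sets reals.
From mathcomp Require Import ring lra.

Import Order.TTheory GRing.Theory Num.Theory.
Local Open Scope ring_scope.

(** Write s(u, v) = u.v + v.u for the generators of Leib, where u.v is the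
product mul u v. Since right multiplications are skew, B (u.v) w changes sign
when u and w are exchanged, so the six terms of B (s(u, v)) w + B (s(v, w)) u + B (s(w, u)) v cancel in
pairs ([cyclic_sum_sym_mul]).

If s takes its values in the line of a vector e <> 0, then s(u, v) = q(u, v) e
and the cyclic identity says that the symmetric product of the quadratic form q and the
linear form a = B e vanishes. As a polynomial function, that product at u = v =
w is 3 q(u, u) a(u), and polynomials over a field of characteristic 0 have no
zero divisors; a is nonzero because B is nondegenerate, hence q = 0 and s = 0
([sym_mul_eq0_of_line]). An antisymmetric Leibniz product is a Lie bracket, so
the algebra is Lie as soon as Leib is contained in a line
([lie_algebra_of_line]); this is the bound on the dimension of Leib.

For the Lorentzian case, the Leibniz identity says that the left multiplications
satisfy [L_u, L_v] = L_(u.v), so L_x = 0 for x in Leib, and skewness turns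
this into the orthogonality of Leib to every product ([sym_mul_ortho]). So Leib is
totally isotropic, and a Lorentzian form leaves room only for isotropic
subspaces of dimension at most 1: the orthogonal of a negative basis vector f
is positive definite, so x |-> B x f is injective on such a subspace
([lorentzian_definite_ortho]). Leib is again contained in a line. *)

Section RQuadratic.
Variables (R : realType) (g : vectType R).
Variables (mul : {bilinear g -> g -> g}) (B : {symmetric g}).

Lemma symmetric_formC u v : B u v = B v u.
Proof. by rewrite hermC expr0 mul1r. Qed.

Lemma nondegenerate_eq0 u : nondegenerate B -> (forall w, B u w = 0) -> u = 0.
Proof.
move=> /eqP ndB uB; apply/eqP; rewrite -memv0 -ndB.
by apply/mem_orthovP => w _; exact: uB.
Qed.

Lemma lie_algebra_of_antisymmetric :
  left_leibniz mul -> (forall u v, mul u v + mul v u = 0) -> lie_algebra mul.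
Proof.
move=> leib sym0.
have anti u v : mul u v = - mul v u by apply/eqP; rewrite -addr_eq0 sym0.
split=> // u v w; rewrite leib (anti w u) linearNr addrK.
by rewrite (anti w) subrr.
Qed.

(** Skewness makes B (x.y) z antisymmetric in x and z; the term with factors in
the order x, y, z cancels the one in the reverse order. *)
Lemma cyclic_sum_sym_mul u v w : (forall x, skew_for B (mul^~ x)) ->
  B (mul u v + mul v u) w + B (mul v w + mul w v) u
    + B (mul w u + mul u w) v = 0.
Proof.
move=> skew.
have swap x y z : B (mul x y) z = - B (mul z y) x by
  rewrite skew symmetric_formC.
rewrite !linearDl /= (swap w v) (swap w u) (swap v w); ring.
Qed.

(** The polarised form of the absence of zero divisors: the cyclic identity is
evaluated at (w, w, w), then at (x, w, w), then at (u, v, w), for a vector w on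
which the linear form B e is nonzero. *)
Lemma sym_mul_eq0_of_line e u v :
    nondegenerate B -> (forall x, skew_for B (mul^~ x)) ->
    (forall x y, mul x y + mul y x \in <[e]>%VS) ->
  mul u v + mul v u = 0.
Proof.
move=> ndB skew line.
have [e0|e_neq0] := eqVneq e 0.
  by have /vlineP[k ->] := line u v; rewrite e0 scaler0.
have [w ew] : exists w, B e w != 0.
  apply: contrapT => noW; case/eqP: e_neq0; apply: nondegenerate_eq0 => // w.
  by apply/eqP; apply: contrapT => /negP ?; apply: noW; exists w.
pose q x y := B (mul x y + mul y x) w / B e w.
have qE x y : mul x y + mul y x = q x y *: e.
  by rewrite /q; have /vlineP[k ->] := line x y; rewrite linearZl_LR /= mulfK.
have cyc x y z : q x y * B e z + q y z * B e x + q z x * B e y = 0.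
  by have := cyclic_sum_sym_mul x y z skew; rewrite !qE !linearZl_LR.
have qC x y : q x y = q y x by rewrite /q addrC.
have qww : q w w = 0.
  apply: (mulIf ew); have := cyc w w w; lra.
have qxw x : q x w = 0.
  apply: (mulIf ew); have := cyc x w w; rewrite qww (qC w x); lra.
rewrite qE (_ : q u v = 0) ?scale0r//; apply: (mulIf ew).
have := cyc u v w; rewrite (qC w u) !qxw; lra.
Qed.

Lemma lie_algebra_of_line e : R_quadratic mul B ->
  (forall x y, mul x y + mul y x \in <[e]>%VS) -> lie_algebra mul.
Proof.
case=> leib ndB skew line; apply: lie_algebra_of_antisymmetric => // u v.
exact: sym_mul_eq0_of_line ndB skew line.
Qed.

Lemma sym_mul_mem_Leib u v : mul u v + mul v u \in Leib mul.
Proof.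
apply/mem_vspan; exists [:: mul u v + mul v u]; last exact/memv_span/mem_head.
by move=> x; rewrite inE => /eqP ->; exists u, v.
Qed.

(** The commutator [L_u, L_v] = L_(u.v) changes sign when u and v are exchanged,
so L_(u.v) + L_(v.u) = 0. *)
Lemma sym_mul_mul_eq0 u v w : left_leibniz mul ->
  mul (mul u v + mul v u) w = 0.
Proof.
move=> leib; apply: (addIr (mul v (mul u w))).
by rewrite add0r linearDl /= addrAC -leib addrC -leib.
Qed.

(** Leib is totally isotropic: by skewness B s (x.y) = - B (s.y) x, and s.y = 0
for a generator s of Leib. *)
Lemma sym_mul_ortho u v u' v' : R_quadratic mul B ->
  B (mul u v + mul v u) (mul u' v' + mul v' u') = 0.
Proof.
case=> leib _ skew.
have ortho x y : B (mul u v + mul v u) (mul x y) = 0.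
  by apply: oppr_inj; rewrite -skew sym_mul_mul_eq0// linear0l oppr0.
by rewrite linearDr /= !ortho addr0.
Qed.
End RQuadratic.

(** The vector f is the negative basis vector: on its orthogonal B is a sum of
squares of coordinates with positive weights. *)
Lemma lorentzian_definite_ortho (R : realType) (g : vectType R)
    (B : {symmetric g}) (p : nat) : has_signature B p 1 ->
  exists f, forall x, B x f = 0 -> B x x = 0 -> x = 0.
Proof.
case=> e [be orth pos neg].
exists (tnth e (rshift p ord0)) => x xf xx.
pose c i := coord e i x.
have xE : x = \sum_i c i *: tnth e i.
  rewrite {1}(coord_basis be (memvf x)); apply: eq_bigr => i _.
  by rewrite (tnth_nth 0).
have Bxe i : B x (tnth e i) = c i * B (tnth e i) (tnth e i).
  rewrite {1}xE linear_sumlz (bigD1 i)//= big1 ?addr0 => [|j ji].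
    by rewrite linearZl_LR.
  by rewrite linearZl_LR /= orth// mulr0.
have cf : c (rshift p ord0) = 0.
  have := Bxe (rshift p ord0); rewrite xf => /esym/eqP.
  by rewrite mulf_eq0 (lt_eqF (neg _)) orbF => /eqP.
have xx_sum : B x x = \sum_(i < p)
    c (lshift 1 i) ^+ 2 * B (tnth e (lshift 1 i)) (tnth e (lshift 1 i)).
  rewrite {2}xE linear_sumr big_split_ord /= big_ord1 cf scale0r linear0r addr0.
  by apply: eq_bigr => i _; rewrite linearZr_LR /= Bxe mulrA expr2.
have cp i : c (lshift 1 i) = 0.
  have term_ge0 j : true -> 0 <= c (lshift 1 j) ^+ 2 *
      B (tnth e (lshift 1 j)) (tnth e (lshift 1 j)).
    by move=> _; rewrite mulr_ge0 ?sqr_ge0 ?ltW.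
  have /eqP := xx; rewrite xx_sum psumr_eq0// => /allP/(_ i).
  rewrite mem_index_enum => /(_ isT).
  by rewrite mulf_eq0 (gt_eqF (pos i)) orbF sqrf_eq0 => /eqP.
rewrite xE big_split_ord /= big_ord1 cf scale0r addr0 big1// => i _.
by rewrite cp scale0r.
Qed.

Theorem corollary6p2 (R : realType) (g : vectType R)
    (mul : {bilinear g -> g -> g}) (B : {symmetric g})
    (hquad : R_quadratic mul B) :
  (~ lie_algebra mul -> (2 <= \dim (Leib mul))%N) /\
  (lorentzian B -> lie_algebra mul).
Proof.
split=> [nlie|/lorentzian_definite_ortho[f fP]].
  rewrite ltnNge; apply/negP => dimL; apply: nlie.
  suff lineL : (Leib mul <= <[vpick (Leib mul)]>)%VS.
    apply: (lie_algebra_of_line _ _ _ _ (vpick (Leib mul)) hquad) => u v.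
    exact: (subvP lineL) (sym_mul_mem_Leib _ _ _ u v).
  have [->|L0] := eqVneq (Leib mul) 0%VS; first exact: sub0v.
  have /eqP -> : <[vpick (Leib mul)]>%VS == Leib mul.
    by rewrite eqEdim -memvE memv_pick dim_vline vpick0 L0.
  exact: subvv.
apply: contrapT => nlie.
have [u [v s_neq0]] : exists u v, mul u v + mul v u != 0.
  apply: contrapT => sym0; apply: nlie.
  case: hquad => leib _ _; apply: lie_algebra_of_antisymmetric => // u v.
  by apply/eqP; apply: contrapT => /negP ?; apply: sym0; exists u, v.
apply/nlie/(lie_algebra_of_line _ _ _ _ (mul u v + mul v u) hquad) => x y.
have orth := sym_mul_ortho _ _ _ _ _ _ _ _ hquad.
set s := mul u v + mul v u in s_neq0 *; set t := mul x y + mul y x.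
have sf : B s f != 0.
  by apply: contra_neq s_neq0 => sf; apply: fP => //; exact: orth.
apply/vlineP; exists (B t f / B s f); apply/eqP; rewrite -subr_eq0; apply/eqP.
(* t - (B t f / B s f) s is orthogonal to f and isotropic, hence zero. *)
apply: fP; rewrite !linearBl /= !linearZl_LR /=; first by rewrite divfK// subrr.
by rewrite !linearBr /= !linearZr_LR /= !orth; ring.
Qed.
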